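(* Let $\mathbf{R}$ be a finite commutative ring with unity. Then $\mathbf{R}$ is (up to isomorphism) a product $R_1\times R_2\times\cdots\times R_n$ where each $R_i$ is a finite local ring, and hence $$\sum_{i=1}^n\chi(R_i)-(n-1)\le \chi(R_1\times R_2\times\cdots\times R_n)\le \sum_{i=1}^n(\chi(R_i)-s_i)+s_1s_2\cdots s_n,$$ where for each $i$, given a proper coloring of $R_i$ with $k_i=\chi(R_i)$ colors and color classes $U^i_1,\ldots,U^i_{k_i}$, $s_i$ denotes the number of indices $m\in\{1,\ldots,k_i\}$ such that $U^i_m$ contains an element $x$ with $x^2=0$.
   Context: All rings are commutative with unity. A ring $R$ is regarded as a simple graph whose vertices are all elements of $R$ (including $0$), two distinct vertices $x,y$ being adjacent if and only if $xy=0$. A proper coloring of $R$ is a partition of $R$ into color classes, each of which is an independent set ($xy\ne 0$ for distinct $x,y$ in the class). The chromatic number $\chi(R)$ is the minimum number of color classes in a proper coloring of $R$. A ring is local if it has a unique maximal ideal. *)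

(* Defs.v *)
From HB Require Import structures.
From mathcomp Require Import all_boot all_order all_algebra.
Set Implicit Arguments.
Unset Strict Implicit.
Unset Printing Implicit Defensive.
Import GRing.Theory.
Local Open Scope ring_scope.

Section ZeroDivisorColoring.
Variable R : finComPzRingType.

Definition adjacent (x y : R) : bool := (x != y) && (x * y == 0).

Definition independent (U : {set R}) : bool :=
  [forall x in U, forall y in U, ~~ adjacent x y].

(* Blocks of a [partition] are nonempty and pairwise disjoint, so #|P| is the
   number of colors. *)
Definition proper_coloring (P : {set {set R}}) : bool :=
  partition P [set: R] && [forall U in P, independent U].

Lemma ex_proper_coloring :
  exists k, [exists P : {set {set R}}, proper_coloring P && (#|P| == k)].
Proof.
pose P := preim_partition id [set: R].
exists #|P|; apply/existsP; exists P; rewrite eqxx andbT /proper_coloring.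
rewrite preim_partitionP /=; apply/forall_inP => U /imsetP[a _ ->].
apply/forall_inP => x; rewrite !inE => /eqP <-.
by apply/forall_inP => y; rewrite !inE => /eqP <-; rewrite /adjacent eqxx.
Qed.

Definition chromatic_number : nat := ex_minn ex_proper_coloring.

Definition num_sqzero_classes (P : {set {set R}}) : nat :=
  #|[set U in P | [exists x in U, x ^+ 2 == 0]]|.

End ZeroDivisorColoring.

(* [idealr_closed] describes proper ideals: it includes 1 \notin I. *)
Definition maximal_ideal (R : finComNzRingType) (M : {set R}) : Prop :=
  idealr_closed M /\
  forall J : {set R}, idealr_closed J -> M \subset J -> J = M.

Definition local_ring (R : finComNzRingType) : Prop :=
  exists! M : {set R}, maximal_ideal M.

(* The direct product of a family of rings, with pointwise operations; it is only a
   possibly-zero ring (Pz), since it is the zero ring when n = 0. *)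
Definition ring_prod (n : nat) (R_ : 'I_n -> finComNzRingType) : Type :=
  {dffun forall i : 'I_n, R_ i}.

Section RingProd.
Variables (n : nat) (R_ : 'I_n -> finComNzRingType).
Local Notation T := (ring_prod R_).

HB.instance Definition _ := Finite.copy T {dffun forall i : 'I_n, R_ i}.

Definition rp_zero : T := [ffun i => 0].
Definition rp_one : T := [ffun i => 1].
Definition rp_opp (f : T) : T := [ffun i => - f i].
Definition rp_add (f g : T) : T := [ffun i => f i + g i].
Definition rp_mul (f g : T) : T := [ffun i => f i * g i].

Fact rp_addA : associative rp_add.
Proof. by move=> f g h; apply/ffunP => i; rewrite !ffunE addrA. Qed.
Fact rp_addC : commutative rp_add.
Proof. by move=> f g; apply/ffunP => i; rewrite !ffunE addrC. Qed.
Fact rp_add0 : left_id rp_zero rp_add.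
Proof. by move=> f; apply/ffunP => i; rewrite !ffunE add0r. Qed.
Fact rp_addN : left_inverse rp_zero rp_opp rp_add.
Proof. by move=> f; apply/ffunP => i; rewrite !ffunE addNr. Qed.

HB.instance Definition _ :=
  GRing.isZmodule.Build T rp_addA rp_addC rp_add0 rp_addN.

Fact rp_mulA : associative rp_mul.
Proof. by move=> f g h; apply/ffunP => i; rewrite !ffunE mulrA. Qed.
Fact rp_mulC : commutative rp_mul.
Proof. by move=> f g; apply/ffunP => i; rewrite !ffunE mulrC. Qed.
Fact rp_mul1 : left_id rp_one rp_mul.
Proof. by move=> f; apply/ffunP => i; rewrite !ffunE mul1r. Qed.
Fact rp_mulDl : left_distributive rp_mul rp_add.
Proof. by move=> f g h; apply/ffunP => i; rewrite !ffunE mulrDl. Qed.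

HB.instance Definition _ :=
  GRing.Zmodule_isComPzRing.Build T rp_mulA rp_mulC rp_mul1 rp_mulDl.

End RingProd.

Definition local_decomposition (R : finComPzRingType) (n : nat)
    (R_ : 'I_n -> finComNzRingType) : Prop :=
  (forall i, local_ring (R_ i)) /\
  exists f : {rmorphism R -> ring_prod R_}, bijective f.

(* Main.v *)
Require Import Defs.
From HB Require Import structures.
From mathcomp Require Import all_boot all_order all_algebra.
From mathcomp Require Import zify.
Set Implicit Arguments.
Unset Strict Implicit.
Unset Printing Implicit Defensive.
Import Order.TTheory GRing.Theory Num.Theory.
Local Open Scope ring_scope.

(** The chromatic bounds come from two constructions.

    Lower bound ([chromatic_number_prod_ge]). In a proper coloring of the product,
    the copy of [R_i] consisting of the elements supported at [i] is colored
    properly, hence with at least [chi(R_i)] colors. Elements of two different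
    copies annihilate each other, so two copies share only the color of [0]. That
    leaves [chi(R_i) - 1] private colors for each [i], and one color for [0].

    Upper bound ([chromatic_number_prod_le]). Distinct elements of one class have a
    nonzero product, and in a class without square-zero elements this is also true
    of an element and itself. Thus a class [U] of [R_i] of this second kind gives an
    independent set of the product, the elements with [i]-th coordinate in [U].
    There are [\sum (chi(R_i) - s_i)] such sets. The elements that they miss have
    all coordinates in classes with square-zero elements, and the tuple of these
    classes colors them with [\prod s_i] further colors.

    The decomposition ([local_decomposition_exists]) uses the primitive idempotents
    [e] of [R]. They are orthogonal with sum [1], so [x |-> (e x)_e] is an
    isomorphism onto the product of the rings [e R]. By primitivity [e R] has only
    the idempotents [0] and [e]. Since every element of a finite ring has an
    idempotent power, each element of [e R] is a unit or nilpotent, which makes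
    [e R] local ([connected_local_ring]). *)

(** * Colorings as functions *)

Section Coloring.
Variable R : finComPzRingType.
Implicit Types (P : {set {set R}}) (x y : R).

Lemma proper_coloring_pblock P x : proper_coloring P -> pblock P x \in P.
Proof. by case/andP=> /and3P[/eqP covP _ _] _; rewrite pblock_mem // covP inE. Qed.

Lemma same_class_mul_neq0 P x y :
  proper_coloring P -> x != y -> pblock P x = pblock P y -> x * y != 0.
Proof.
move=> colP xDy eq_xy; have Px := proper_coloring_pblock x colP.
case/andP: colP => /and3P[/eqP covP _ _] /forall_inP/(_ _ Px) indep.
have x_in : x \in pblock P x by rewrite mem_pblock covP inE.
have y_in : y \in pblock P x by rewrite eq_xy mem_pblock covP inE.
by move/forall_inP/(_ x x_in)/forall_inP/(_ y y_in): indep; rewrite /adjacent xDy.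
Qed.

Lemma notin_sqzero_class P x :
  proper_coloring P ->
  pblock P x \notin [set U in P | [exists x in U, x ^+ 2 == 0]] -> x * x != 0.
Proof.
move=> colP; rewrite inE proper_coloring_pblock //=; apply: contra => /eqP x2.
apply/exists_inP; exists x; last by rewrite expr2 x2.
by case/andP: colP => /and3P[/eqP covP _ _] _; rewrite mem_pblock covP inE.
Qed.

Lemma chromatic_number_attained :
  exists2 P : {set {set R}}, proper_coloring P & #|P| = chromatic_number R.
Proof.
rewrite /chromatic_number; case: ex_minnP => k /existsP[P /andP[colP /eqP<-]] _.
by exists P.
Qed.

(** A map that separates adjacent vertices colors [R] by its fibers; the set [D]
    of colors may be larger than its image, which frees the applications from
    computing images. *)
Lemma chromatic_number_le (C : finType) (c : R -> C) (D : {set C}) :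
  (forall x, c x \in D) -> (forall x y, x != y -> c x = c y -> x * y != 0) ->
  (chromatic_number R <= #|D|)%N.
Proof.
move=> cD sepc; pose P := preim_partition c [set: R].
have colP : proper_coloring P.
  rewrite /proper_coloring preim_partitionP; apply/forall_inP => U.
  case/imsetP=> a _ ->; apply/forall_inP => x; rewrite !inE => /eqP ax.
  apply/forall_inP => y; rewrite !inE => /eqP ay.
  by rewrite /adjacent; have [//|xDy] := eqVneq x y; rewrite sepc -?ax.
have leP : (#|P| <= #|D|)%N.
  apply: leq_trans (leq_imset_card (fun k => c @^-1: [set k]) (mem D)).
  apply/subset_leq_card/subsetP => U /imsetP[a _ ->].
  apply/imsetP; exists (c a); first exact: cD.
  by apply/setP => y; rewrite !inE eq_sym.
rewrite /chromatic_number; case: ex_minnP => k _ kmin.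
by apply: leq_trans leP; apply: kmin; apply/existsP; exists P; rewrite colP eqxx.
Qed.

End Coloring.

(** * Bounds for the chromatic number of a product *)

Section ProductBounds.
Variables (n : nat) (R_ : 'I_n -> finComNzRingType).
Local Notation T := (ring_prod R_).

Definition factor_inj (i : 'I_n) (x : R_ i) : T :=
  finfun (dfwith (fun j => 0 : R_ j) x).

Lemma factor_inj_in i (x : R_ i) : factor_inj x i = x.
Proof. by rewrite ffunE dfwith_in. Qed.

Lemma factor_inj_out i j (x : R_ i) : i != j -> factor_inj x j = 0.
Proof. by move=> ij; rewrite ffunE dfwith_out. Qed.

Lemma factor_injM i (x y : R_ i) :
  factor_inj x * factor_inj y = factor_inj (x * y).
Proof.
apply/ffunP => j; rewrite [LHS]ffunE.
have [<-|ij] := eqVneq i j; first by rewrite !factor_inj_in.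
by rewrite !factor_inj_out // mulr0.
Qed.

Lemma factor_inj_eq0 i (x : R_ i) : (factor_inj x == 0) = (x == 0).
Proof.
apply/eqP/eqP => [/ffunP/(_ i)|->]; first by rewrite factor_inj_in ffunE.
apply/ffunP => j; rewrite [RHS]ffunE.
by have [<-|ij] := eqVneq i j; rewrite ?factor_inj_in ?factor_inj_out.
Qed.

Lemma factor_inj_ortho i j (x : R_ i) (y : R_ j) :
  i != j -> factor_inj x * factor_inj y = 0.
Proof.
move=> ij; apply/ffunP => k; rewrite [LHS]ffunE [RHS]ffunE.
have [ik|ik] := eqVneq i k; last by rewrite factor_inj_out ?mul0r.
by rewrite (@factor_inj_out j) ?mulr0 // -ik eq_sym.
Qed.

(** The sets [A i] of colors of nonzero elements supported at [i] are pairwise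
    disjoint and avoid the color of [0], because [0] is adjacent to all other
    vertices. The colors in [A i] and that of [0] together color [R_ i] properly.
    Stated additively to avoid truncated subtraction when [n = 0]. *)
Lemma chromatic_number_prod_ge :
  ((\sum_(i < n) chromatic_number (R_ i)).+1 <= chromatic_number T + n)%N.
Proof.
have [P colP <-] := chromatic_number_attained T.
pose c (f : T) := pblock P f.
have cP f : c f \in P by apply: proper_coloring_pblock.
pose A i := [set c (factor_inj x) | x in [set~ (0 : R_ i)]].
have c0A i : c 0 \notin A i.
  apply/imsetP => -[x]; rewrite !inE -factor_inj_eq0 eq_sym => x0 c0.
  by have := same_class_mul_neq0 colP x0 c0; rewrite mul0r eqxx.
have disjA i j : i != j -> [disjoint A i & A j].
  move=> ij; apply/pred0P => U /=; apply/negP => /andP[/imsetP[x x0 ->]].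
  case/imsetP=> y _ eq_c; rewrite !inE in x0.
  have [eq_xy|xDy] := eqVneq (factor_inj x) (factor_inj y).
    move: x0; rewrite -factor_inj_eq0 => /eqP[]; apply/ffunP => k.
    rewrite [RHS]ffunE; have [ik|ik] := eqVneq i k; last by rewrite factor_inj_out.
    by rewrite eq_xy factor_inj_out // -ik eq_sym.
  by have := same_class_mul_neq0 colP xDy eq_c; rewrite factor_inj_ortho ?eqxx.
have chiA i : (chromatic_number (R_ i) <= #|A i|.+1)%N.
  rewrite -add1n -[(1 + _)%N]/(true + _)%N -(c0A i) -cardsU1.
  apply: (@chromatic_number_le _ _ (fun x => c (factor_inj x))) => [x|x y xDy eq_c].
    apply/setU1P; have [->|x0] := eqVneq x 0.
      by left; congr c; apply/eqP; rewrite factor_inj_eq0.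
    by right; apply/imsetP; exists x; rewrite ?inE.
  rewrite -factor_inj_eq0 -factor_injM; apply: same_class_mul_neq0 eq_c => //.
  by apply: contra xDy => /eqP/ffunP/(_ i); rewrite !factor_inj_in => ->.
have cardA : (\sum_(i < n) #|A i|).+1 = #|c 0 |: \bigcup_(i < n) A i|.
  rewrite cardsU1; have -> : c 0 \notin \bigcup_i A i.
    by apply/bigcupP => -[i _]; rewrite (negPf (c0A i)).
  rewrite add1n -sum1_card partition_disjoint_bigcup //; congr _.+1.
  by apply: eq_bigr => i _; rewrite sum1_card.
have leA : ((\sum_(i < n) #|A i|).+1 <= #|P|)%N.
  rewrite cardA; apply/subset_leq_card/subsetP => U.
  by case/setU1P=> [->//|/bigcupP[i _ /imsetP[x _ ->]]].
apply: leq_trans (leq_add leA (leqnn n)); rewrite addSn ltnS.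
have -> : (\sum_(i < n) #|A i| + n = \sum_(i < n) #|A i|.+1)%N.
  by under [RHS]eq_bigr do rewrite -addn1; rewrite big_split sum_nat_const card_ord muln1.
by apply: leq_sum => i _; apply: chiA.
Qed.

Variable P : forall i : 'I_n, {set {set R_ i}}.
Hypothesis colP : forall i, proper_coloring (P i).

Let Z i := [set U in P i | [exists x in U, x ^+ 2 == 0]].

(** An index whose class has no square-zero element certifies on its own that
    the product is nonzero, so one such index and its class suffice as a color;
    which index is picked is irrelevant. Only without such an index does the
    color have to remember the whole tuple of classes. *)
Let prod_color (f : T) :
    {i : 'I_n & {set R_ i}} + {dffun forall i, {set R_ i}} :=
  if [pick i | pblock (P i) (f i) \notin Z i] is Some i
  then inl (Tagged (fun i => {set R_ i}) (pblock (P i) (f i)))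
  else inr [ffun i => pblock (P i) (f i)].

(** Two elements with the color [(i, U)] have a nonzero product at [i]: if their
    [i]-th coordinates agree this is because [U] has no square-zero element. Two
    elements with the same tuple of classes have a nonzero product at any index
    where they differ. *)
Let prod_color_sep (f g : T) : f != g -> prod_color f = prod_color g -> f * g != 0.
Proof.
have nz i : f i * g i != 0 -> f * g != 0.
  by apply: contra => /eqP/ffunP/(_ i); rewrite !ffunE => ->.
move=> fDg; rewrite /prod_color; case: pickP => [i fiZ|_].
  case: pickP => [j _ [eq_ij]|//]; rewrite -{}eq_ij => /eqP.
  rewrite eq_Tagged /= => /eqP eq_c; apply: (nz i).
  have [eq_fg|] := eqVneq (f i) (g i); last by move/(same_class_mul_neq0 (colP i)); apply.
  by rewrite -eq_fg; apply: notin_sqzero_class fiZ.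
case: pickP => // _ [] /ffunP eq_c.
have [i fgi] : exists i, f i != g i.
  apply/existsP; apply: contraR fDg; rewrite negb_exists => /forallP eq_fg.
  by apply/eqP/ffunP => i; apply/eqP; rewrite -[_ == _]negbK eq_fg.
by apply: (nz i); apply: same_class_mul_neq0 (colP i) fgi _; move: (eq_c i); rewrite !ffunE.
Qed.

Lemma chromatic_number_prod_le :
  (chromatic_number T <=
     \sum_(i < n) (#|P i| - num_sqzero_classes (P i)) +
       \prod_(i < n) num_sqzero_classes (P i))%N.
Proof.
pose A := [set u : {i : 'I_n & {set R_ i}} | tagged u \in P (tag u) :\: Z (tag u)].
pose F := [set t : {dffun forall i, {set R_ i}} | t \in family (fun i => mem (Z i))].
have cardA : #|A| = (\sum_(i < n) (#|P i| - #|Z i|))%N.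
  rewrite -sum1_card (eq_bigl (fun u => tagged u \in P (tag u) :\: Z (tag u))); last first.
    by move=> u; rewrite inE.
  rewrite -(sig_big_dep xpredT (fun i U => U \in P i :\: Z i) (fun _ _ => 1%N)) /=.
  apply: eq_bigr => i _; rewrite sum1_card cardsD (setIidPr _) //.
  by apply/subsetP => U; rewrite inE => /andP[].
have cardF : #|F| = (\prod_(i < n) #|Z i|)%N.
  rewrite cardsE card_family foldrE big_map enumT -[index_enum _]enumT.
  by rewrite big_enum.
rewrite -cardA -cardF.
rewrite -(card_imset _ (@inl_inj _ {dffun forall i, {set R_ i}})).
rewrite -(card_imset F (@inr_inj {i : 'I_n & {set R_ i}} _)).
apply: leq_trans (leq_card_setU _ _).1.
apply: (chromatic_number_le (c := prod_color)) prod_color_sep => f.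
rewrite /prod_color inE; case: pickP => [i fiZ|fZ].
  by rewrite imset_f // inE in_setD /= fiZ proper_coloring_pblock.
rewrite orbC imset_f // inE; apply/familyP => i; rewrite ffunE.
by move: (fZ i) => /negbFE.
Qed.

End ProductBounds.

(** * Decomposition of a finite ring into local rings *)

(** Two powers of [x] coincide, so the powers of [x] are eventually periodic; an
    exponent past the preperiod that is a multiple of the period works. *)
Lemma idempotent_power (R : finComPzRingType) (x : R) :
  exists k, (x ^+ k) * (x ^+ k) = x ^+ k /\ (0 < k)%N.
Proof.
have /injectivePn[i [j ij eq_x]] :
    ~~ injectiveb (fun i : 'I_#|R|.+1 => x ^+ i).
  by apply/injectiveP => /leq_card; rewrite card_ord ltnn.
wlog lt_ij : i j ij eq_x / (i < j)%N.
  move=> wlog_lt; have [lt|lt|/val_inj eq] := ltngtP i j.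
  - exact: wlog_lt lt.
  - by apply: wlog_lt lt; rewrite // eq_sym.
  by rewrite eq eqxx in ij.
pose d := (j - i)%N.
have period m l : (i <= m)%N -> x ^+ (m + d * l) = x ^+ m.
  move=> le_im; elim: l => [|l IHl]; first by rewrite muln0 addn0.
  rewrite -[RHS]IHl.
  have -> : (m + d * l.+1 = j + (m - i + d * l))%N by rewrite mulnS /d; lia.
  rewrite exprD -eq_x -exprD; congr (_ ^+ _); lia.
have d_gt0 : (0 < d)%N by rewrite subn_gt0.
exists (d * i.+1)%N; split; last by rewrite muln_gt0 d_gt0.
by rewrite -exprD period //; apply/ltnW/leq_pmull.
Qed.

(** By [idempotent_power], every element of such a ring is either a unit or
    nilpotent. Hence the non-units form an ideal, and this ideal contains all
    proper ideals. *)
Lemma connected_local_ring (A : finComNzRingType) :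
  (forall x : A, x * x = x -> x = 0 \/ x = 1) -> local_ring A.
Proof.
move=> idem01; pose M := [set x : A | ~~ [exists y, x * y == 1]].
have unitI (x y : A) : x * y = 1 -> x \notin M.
  by move=> xy; rewrite inE negbK; apply/existsP; exists y; rewrite xy.
have nilM (x : A) : x \in M -> exists k, x ^+ k = 0.
  move=> Mx; have [[|k] [idk k_gt0]] := idempotent_power x; first by [].
  case: (idem01 _ idk) => xk; first by exists k.+1.
  by rewrite exprS in xk; rewrite (negPf (unitI _ _ xk)) in Mx.
have idM : idealr_closed M.
  split=> [||a u v Mu Mv].
  - by rewrite inE; apply/existsP => -[y]; rewrite mul0r eq_sym oner_eq0.
  - by apply: (unitI 1 1); rewrite mulr1.
  apply: contraT; rewrite inE negbK => /existsP[w /eqP uvw].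
  have [k nil_t] : exists k, (u * (a * w)) ^+ k = 0.
    by have [k uk] := nilM _ Mu; exists k; rewrite exprMn uk mul0r.
  (* v w = 1 - u (a w) with u (a w) nilpotent, so the geometric sum inverts v w *)
  pose t := u * (a * w); pose s := \sum_(i < k) t ^+ i.
  have vw : v * w = 1 - t by rewrite -uvw mulrDl /t mulrCA mulrA [RHS]addrC addKr.
  have /unitI : v * (w * s) = 1.
    by rewrite mulrA vw -opprB mulNr -subrX1 nil_t sub0r opprK.
  by rewrite Mv.
have subM (J : {set A}) : idealr_closed J -> J \subset M.
  case=> J0 J1 Jlin; apply/subsetP => x Jx; apply: contraR J1.
  rewrite inE negbK => /existsP[y /eqP xy].
  by rewrite -xy mulrC -[_ * _]addr0 Jlin.
exists M; split.
  by split=> // J idJ MJ; apply/eqP; rewrite eqEsubset subM.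
by move=> J [idJ maxJ]; apply: maxJ => //; apply: subM.
Qed.

(** The ideal [e R], which is a ring with unit [e]. The proofs that [e] is a
    nonzero idempotent are arguments so that the ring structure can be inferred
    from the type. *)
Definition corner (R : finComPzRingType) (e : R) of e * e = e & e != 0 :=
  {x : R | e * x == x}.

Section Corner.
Variables (R : finComPzRingType) (e : R) (ee : e * e = e) (e0 : e != 0).
Local Notation C := (corner ee e0).

HB.instance Definition _ := Finite.copy C {x : R | e * x == x}.

Definition corner_proj (x : R) : C :=
  exist _ (e * x) (introT eqP (etrans (mulrA e e x) (congr1 ( *%R^~ x) ee))).

Lemma val_corner_proj x : val (corner_proj x) = e * x. Proof. by []. Qed.

Lemma corner_mul (a : C) : e * val a = val a.
Proof. exact/eqP/(valP a). Qed.

Let add (a b : C) := corner_proj (val a + val b).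
Let opp (a : C) := corner_proj (- val a).
Let mul (a b : C) := corner_proj (val a * val b).
Let one : C := corner_proj 1.
Let zero : C := corner_proj 0.

Let addE a b : val (add a b) = val a + val b.
Proof. by rewrite /= mulrDr !corner_mul. Qed.
Let oppE a : val (opp a) = - val a.
Proof. by rewrite /= mulrN corner_mul. Qed.
Let mulE a b : val (mul a b) = val a * val b.
Proof. by rewrite /= mulrA corner_mul. Qed.
Let zeroE : val zero = 0. Proof. exact: mulr0. Qed.
Let oneE : val one = e. Proof. exact: mulr1. Qed.

Fact corner_addA : associative add.
Proof. by move=> a b c; apply: val_inj; rewrite !addE addrA. Qed.
Fact corner_addC : commutative add.
Proof. by move=> a b; apply: val_inj; rewrite !addE addrC. Qed.
Fact corner_add0 : left_id zero add.
Proof. by move=> a; apply: val_inj; rewrite addE zeroE add0r. Qed.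
Fact corner_addN : left_inverse zero opp add.
Proof. by move=> a; apply: val_inj; rewrite addE oppE zeroE addNr. Qed.

HB.instance Definition _ :=
  GRing.isZmodule.Build C corner_addA corner_addC corner_add0 corner_addN.

Fact corner_mulA : associative mul.
Proof. by move=> a b c; apply: val_inj; rewrite !mulE mulrA. Qed.
Fact corner_mulC : commutative mul.
Proof. by move=> a b; apply: val_inj; rewrite !mulE mulrC. Qed.
Fact corner_mul1 : left_id one mul.
Proof. by move=> a; apply: val_inj; rewrite mulE oneE corner_mul. Qed.
Fact corner_mulDl : left_distributive mul +%R.
Proof. by move=> a b c; apply: val_inj; rewrite !(mulE, addE) mulrDl. Qed.
Fact corner_one_neq0 : one != 0.
Proof. by rewrite -(inj_eq val_inj) oneE zeroE. Qed.

HB.instance Definition _ := GRing.Zmodule_isComNzRing.Build C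
  corner_mulA corner_mulC corner_mul1 corner_mulDl corner_one_neq0.

Lemma val_corner0 : val (0 : C) = 0. Proof. exact: zeroE. Qed.
Lemma val_corner1 : val (1 : C) = e. Proof. exact: oneE. Qed.
Lemma val_cornerM (a b : C) : val (a * b) = val a * val b. Proof. exact: mulE. Qed.

Lemma corner_projB : zmod_morphism corner_proj.
Proof. by move=> x y; apply: val_inj; rewrite [RHS]addE oppE /= mulrBr. Qed.

Lemma corner_projM : monoid_morphism corner_proj.
Proof. by split=> // x y; apply: val_inj; rewrite [RHS]mulE /= mulrACA ee. Qed.

End Corner.

Section Decomposition.
Variable R : finComPzRingType.
Implicit Types e f u : R.

(** Primitive idempotents are the minimal nonzero ones for the order
    [f <= e := (f * e = f)]. *)
Definition primitive_idempotent : {set R} :=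
  [set e | [&& e * e == e, e != 0 &
     [forall f, [&& f * f == f, f != 0 & f * e == f] ==> (f == e)]]].

Lemma primitive_idempotentP e : e \in primitive_idempotent ->
  [/\ e * e = e, e != 0 &
      forall f, f * f = f -> f != 0 -> f * e = f -> f = e].
Proof.
rewrite inE => /and3P[/eqP ee e0 /forallP min]; split=> // f ff f0 fe.
by apply/eqP; apply: (implyP (min f)); rewrite ff fe f0 !eqxx.
Qed.

Lemma primitive_idempotent_ortho e f :
  e \in primitive_idempotent -> f \in primitive_idempotent -> e != f -> e * f = 0.
Proof.
case/primitive_idempotentP=> ee _ mine /primitive_idempotentP[ff _ minf].
apply: contraNeq => ef0.
have idef : e * f * (e * f) = e * f by rewrite mulrACA ee ff.
have <- : e * f = e by apply: mine; rewrite // mulrAC ee.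
by apply/eqP; apply: minf; rewrite // -mulrA ff.
Qed.

(** A nonzero idempotent below [u] that generates an ideal of least cardinality
    is primitive. *)
Lemma primitive_idempotent_below u : u * u = u -> u != 0 ->
  exists2 e, e \in primitive_idempotent & e * u = e.
Proof.
move=> uu u0; pose I e := [set e * x | x : R].
pose Q e := [&& e * e == e, e != 0 & e * u == e].
have Qu : Q u by rewrite /Q uu u0 !eqxx.
case: (arg_minnP (fun e => #|I e|) Qu) => e /and3P[/eqP ee e0 /eqP eu] min.
exists e => //; rewrite inE ee e0 eqxx; apply/forallP => f.
apply/implyP => /and3P[/eqP ff f0 /eqP fe].
have Qf : Q f by rewrite /Q ff f0 -fe -mulrA eu !eqxx.
have subI : I f \subset I e.
  by apply/subsetP => _ /imsetP[x _ ->]; rewrite -fe mulrAC [f * x * e]mulrC imset_f.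
have /eqP eqI : I f == I e by rewrite eqEcard subI min.
have /imsetP[x _ def_e] : e \in I f by rewrite eqI -{1}ee imset_f.
by rewrite -fe def_e mulrA ff.
Qed.

(** Otherwise [1 - \sum e] would be a nonzero idempotent orthogonal to every
    primitive one, although it lies above one of them. *)
Lemma sum_primitive_idempotent : \sum_(e in primitive_idempotent) e = 1.
Proof.
set s := \sum_(e in _) e.
have es e : e \in primitive_idempotent -> e * s = e.
  move=> e_prim; rewrite mulr_sumr (bigD1 e) //= big1 ?addr0.
    by case/primitive_idempotentP: e_prim.
  by move=> f /andP[f_prim fDe]; apply: primitive_idempotent_ortho; rewrite // eq_sym.
have ss : s * s = s by rewrite {1}/s mulr_suml; apply: eq_bigr.
apply/esym/eqP; rewrite -subr_eq0; apply: contraT => u0.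
have uu : (1 - s) * (1 - s) = 1 - s by rewrite mulrBl mul1r mulrBr mulr1 ss subrr subr0.
have [e e_prim] := primitive_idempotent_below uu u0.
rewrite mulrBr mulr1 es // subrr => /esym e0.
by have [_ /eqP] := primitive_idempotentP e_prim.
Qed.

Lemma corner_primitive_local e (ee : e * e = e) (e0 : e != 0) :
  e \in primitive_idempotent -> local_ring (corner ee e0).
Proof.
case/primitive_idempotentP=> _ _ mine; apply: connected_local_ring => x xx.
have [->|x0] := eqVneq x 0; [by left | right].
apply: val_inj; rewrite val_corner1; apply: mine.
- by rewrite -val_cornerM xx.
- by rewrite -(val_corner0 ee e0) (inj_eq val_inj).
by rewrite mulrC corner_mul.
Qed.

Let n := #|primitive_idempotent|.
Let idem (i : 'I_n) : R := enum_val i.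
Let idemP i := primitive_idempotentP (enum_valP i).
Let idemM i : idem i * idem i = idem i. Proof. by case: (idemP i). Qed.
Let idem_neq0 i : idem i != 0. Proof. by case: (idemP i). Qed.

Definition local_factor (i : 'I_n) : finComNzRingType :=
  corner (idemM i) (idem_neq0 i).

Definition to_factors (x : R) : ring_prod local_factor :=
  [ffun i => corner_proj (idemM i) (idem_neq0 i) x].

Fact to_factors_is_zmod_morphism : zmod_morphism to_factors.
Proof. by move=> x y; apply/ffunP => i; rewrite !ffunE; apply: corner_projB. Qed.

Fact to_factors_is_monoid_morphism : monoid_morphism to_factors.
Proof.
split=> [|x y]; apply/ffunP => i; rewrite !ffunE; last exact: (corner_projM _ _).2.
exact: (corner_projM _ _).1.
Qed.

HB.instance Definition _ := GRing.isZmodMorphism.Build R (ring_prod local_factor)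
  to_factors to_factors_is_zmod_morphism.
HB.instance Definition _ := GRing.isMonoidMorphism.Build R (ring_prod local_factor)
  to_factors to_factors_is_monoid_morphism.

(** The inverse adds up the components: [\sum_i e_i x = x] because the [e_i] sum
    to [1], and [e_j * \sum_i g_i = g_j] because they are orthogonal. *)
Lemma to_factors_bij : bijective to_factors.
Proof.
exists (fun g : ring_prod local_factor => \sum_(i < n) (val (g i) : R)) => [x|g].
  rewrite (eq_bigr (fun i => idem i * x)) => [|i _]; last by rewrite ffunE.
  rewrite -mulr_suml -(big_enum_val id).
  by rewrite sum_primitive_idempotent mul1r.
apply/ffunP => j; rewrite ffunE; apply: val_inj; rewrite val_corner_proj.
rewrite mulr_sumr (bigD1 j) //= corner_mul big1 ?addr0 // => i iDj.
have /primitive_idempotent_ortho ortho : idem j != idem i.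
  by apply: contra iDj => /eqP/enum_val_inj ->.
by rewrite -corner_mul mulrA ortho ?mul0r ?enum_valP.
Qed.

Lemma local_decomposition_exists :
  exists (n : nat) (R_ : 'I_n -> finComNzRingType), local_decomposition R R_.
Proof.
exists n, local_factor; split; last by exists to_factors; exact: to_factors_bij.
by move=> i; apply: corner_primitive_local; apply: enum_valP.
Qed.

End Decomposition.

Theorem corollary3p4 (R : finComPzRingType) :
  (exists (n : nat) (R_ : 'I_n -> finComNzRingType), local_decomposition R R_)
  /\
  (forall (n : nat) (R_ : 'I_n -> finComNzRingType),
     local_decomposition R R_ ->
     (\sum_(i < n) (chromatic_number (R_ i))%:Z - (n%:Z - 1)
        <= (chromatic_number (ring_prod R_))%:Z)
     /\
     (forall P : forall i : 'I_n, {set {set R_ i}},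
        (forall i, proper_coloring (P i) /\
                   #|P i| = chromatic_number (R_ i)) ->
      (chromatic_number (ring_prod R_))%:Z
        <= \sum_(i < n) ((chromatic_number (R_ i))%:Z -
                             (num_sqzero_classes (P i))%:Z)
           + \prod_(i < n) (num_sqzero_classes (P i))%:Z)).
Proof.
split=> [|n R_ _]; first exact: local_decomposition_exists.
split=> [|P colP].
  have := chromatic_number_prod_ge R_.
  rewrite -(big_morph Posz PoszD (erefl 0%:Z)).
  move: (chromatic_number _) (\sum_(i < n) _)%N => chi s; lia.
have := chromatic_number_prod_le (fun i => (colP i).1).
rewrite -lez_nat PoszD (big_morph Posz PoszD (erefl 0%:Z)).
rewrite (big_morph Posz PoszM (erefl 1%:Z)).
congr (_ <= _ + _); apply: eq_bigr => i _; rewrite -(colP i).2 subzn //.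
by apply/subset_leq_card/subsetP => U; rewrite inE => /andP[].
Qed.
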